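(* Let $n \geq k+1$ be positive integers such that $k \leq \lfloor n/2 \rfloor$. Then $\mathrm{Spec}(P_n, k)=\{2, 3, \ldots, k+1\}$.
   Context: $P_n$ is the path on $n$ vertices $v_1,\dots,v_n$ (in order), with graph distance $\mathrm{dist}(v_i,v_j)=|i-j|$; its diameter is $n-1$. For a set $D$ of positive integers, the distance graph $G(P_n,D)$ has vertex set $\{v_1,\dots,v_n\}$, with $v_i,v_j$ ($i\ne j$) adjacent iff $|i-j|\in D$; $\chi(P_n,D)$ is its chromatic number. The Babai $k$-spectrum is $\mathrm{Spec}(P_n,k)=\{\chi(P_n,D): D\subseteq\{1,2,\dots,n-1\},\ |D|=k\}$. *)

(* Defs.v *)
From HB Require Import structures.
From mathcomp Require Import all_boot all_order all_algebra finmap.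

Set Implicit Arguments.
Unset Strict Implicit.
Unset Printing Implicit Defensive.

Record sgraph := SGraph {
  vertex :> finType;
  adj : rel vertex;
  adj_sym : symmetric adj;
  adj_irrefl : irreflexive adj }.

Definition proper_coloring (G : sgraph) (C : eqType) (f : G -> C) : bool :=
  [forall x, forall y, adj x y ==> (f x != f y)].

Definition colorable (G : sgraph) (c : nat) : bool :=
  [exists f : {ffun G -> 'I_c}, proper_coloring f].

Lemma colorable_ex (G : sgraph) : exists c, colorable G c.
Proof.
exists #|G|; apply/existsP; exists [ffun x => enum_rank x].
apply/forallP=> x; apply/forallP=> y; apply/implyP=> xy; rewrite !ffunE.
by apply: contraTneq xy => /enum_rank_inj ->; rewrite adj_irrefl.
Qed.

Definition chromatic_number (G : sgraph) : nat := ex_minn (colorable_ex G).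

(* The ordinal i : 'I_n is the vertex v_{i+1} of the path P_n. *)
Definition path_dist (n : nat) (i j : 'I_n) : nat := `|i - j|%N.

Definition distance_adj (n : nat) (D : {fset nat}) : rel 'I_n :=
  [rel i j | (i != j) && (path_dist i j \in D)].

Lemma distance_adj_sym (n : nat) (D : {fset nat}) :
  symmetric (@distance_adj n D).
Proof. by move=> i j; rewrite /distance_adj /= eq_sym /path_dist distnC. Qed.

Lemma distance_adj_irrefl (n : nat) (D : {fset nat}) :
  irreflexive (@distance_adj n D).
Proof. by move=> i; rewrite /distance_adj /= eqxx. Qed.

Definition distance_graph (n : nat) (D : {fset nat}) : sgraph :=
  SGraph (@distance_adj_sym n D) (@distance_adj_irrefl n D).

Definition chi_path (n : nat) (D : {fset nat}) : nat :=
  chromatic_number (distance_graph n D).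

(* The integers from a to b, both included. *)
Definition nat_range (a b : nat) : {fset nat} :=
  [fset x in index_iota a b.+1]%fset.

Definition Spec (n k : nat) : {fset nat} :=
  [fset chi_path n D | D in fpowerset (nat_range 1 (n - 1)) & #|` D| == k]%fset.

(* Main.v *)
Require Import Defs.
From mathcomp Require Import all_boot all_order all_algebra finmap.
From mathcomp Require Import zify.

Set Implicit Arguments.
Unset Strict Implicit.
Unset Printing Implicit Defensive.

(** Colouring the vertices greedily from left to right, each vertex has at most
    [#|D|] earlier neighbours, so [chi <= k + 1]; and [D] nonempty gives an edge,
    so [2 <= chi].  Conversely, for [2 <= m <= k + 1], let [D] be the set of the
    [k] smallest positive integers not divisible by [m]; they all are at most
    [n - 1] because [k <= n / 2].  Then [i |-> i mod m] is a proper colouring, and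
    [D] contains [1, ..., m - 1], so the first [m] vertices form a clique. *)

Lemma chromatic_number_colorable (G : sgraph) : colorable G (chromatic_number G).
Proof. by rewrite /chromatic_number; case: ex_minnP. Qed.

Lemma chromatic_number_le (G : sgraph) (c : nat) :
  colorable G c -> chromatic_number G <= c.
Proof. by rewrite /chromatic_number; case: ex_minnP => c0 _; apply. Qed.

(** A proper colouring composed with [h] is injective, because distinct points have adjacent
    images. *)
Lemma clique_colorable (G : sgraph) (T : finType) (h : T -> G) (c : nat) :
  (forall x y, x != y -> adj (h x) (h y)) -> colorable G c -> #|T| <= c.
Proof.
move=> clique /existsP[f /forallP fP]; rewrite -[c]card_ord.
apply: (leq_card (fun x => f (h x))) => x y fxy; apply/eqP.
have /forallP/(_ (h y))/implyP fP' := fP (h x).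
by apply: contraTT isT => /clique/fP'; rewrite fxy eqxx.
Qed.

(** Colouring all of [nat] lets a colouring be extended by induction on [n] or be given by a
    formula; by symmetry, pairs [i < j] suffice. *)
Lemma distance_colorable (n c : nat) (D : {fset nat}) (f : nat -> nat) :
  (forall i, f i < c) ->
  (forall i j, i < j < n -> j - i \in D -> f i != f j) ->
  colorable (distance_graph n D) c.
Proof.
move=> f_lt fP; apply/existsP; exists [ffun i : 'I_n => Ordinal (f_lt i)].
apply/forallP=> x; apply/forallP=> y; apply/implyP=> /andP[].
rewrite !ffunE -val_eqE /= /path_dist => xy; rewrite -val_eqE /=.
case: (ltngtP x y) xy => // lt_xy _ xyD.
  by apply: fP; rewrite ?lt_xy ?ltn_ord // -distnEr // ltnW.
by rewrite eq_sym; apply: fP; rewrite ?lt_xy ?ltn_ord // -distnEl // ltnW.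
Qed.

Lemma greedy_coloring (n : nat) (D : {fset nat}) :
  exists f : nat -> nat, (forall i, f i < #|` D|.+1) /\
    (forall i j, i < j < n -> j - i \in D -> f i != f j).
Proof.
elim: n => [|n [f [f_lt fP]]]; first by exists (fun=> 0); split=> // i j; lia.
(* Colours to avoid at the new vertex [n]. A distance [d > n] has no earlier neighbour; truncated
   subtraction then only forbids [f 0] as well, and [s] still has length [#|D|]. *)
pose s := [seq f (n - d) | d <- D].
have [c c_lt cs] : exists2 c, c < #|` D|.+1 & c \notin s.
  (* Pigeonhole: [#|D| + 1] distinct colours cannot all occur in [s]. *)
  have : ~~ all (mem s) (iota 0 #|` D|.+1).
    apply/negP=> /allP /(uniq_leq_size (iota_uniq _ _)).
    by rewrite size_iota size_map ltnn.
  by case/allPn=> c; rewrite mem_iota => c_lt cs; exists c.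
exists (fun i => if i == n then c else f i); split=> [i|i j ij ijD].
  by case: eqP.
have -> : (i == n) = false by lia.
case: (j =P n) => [jn|jn]; last by apply: fP => //; lia.
apply: contraNneq cs => <-; apply/mapP; exists (j - i) => //.
by congr f; lia.
Qed.

Lemma chi_path_le (n : nat) (D : {fset nat}) : chi_path n D <= #|` D| + 1.
Proof.
have [f [f_lt fP]] := greedy_coloring n D.
by apply: chromatic_number_le; rewrite addn1; apply: distance_colorable fP.
Qed.

Lemma mem_nat_range (a b x : nat) : (x \in nat_range a b) = (a <= x <= b).
Proof. by rewrite /nat_range in_fset_ /= mem_index_iota ltnS. Qed.

Lemma chi_path_ge (n m : nat) (D : {fset nat}) (h : 'I_m -> 'I_n) :
  (forall x y, x != y -> distance_adj D (h x) (h y)) -> m <= chi_path n D.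
Proof.
move=> clique; rewrite -[m]card_ord.
by apply: (@clique_colorable (distance_graph n D) _ h) => //;
  apply: chromatic_number_colorable.
Qed.

Lemma chi_path_ge2 (n d : nat) (D : {fset nat}) :
  0 < d < n -> d \in D -> 2 <= chi_path n D.
Proof.
case/andP=> d_gt0 d_lt dD; have n_gt0 : 0 < n by lia.
(* The edge joining the vertices of index 0 and [d]. *)
pose h (x : 'I_2) := if x == ord0 then Ordinal n_gt0 else Ordinal d_lt.
apply: (@chi_path_ge _ _ _ h) => x y xy.
rewrite /distance_adj /= /path_dist -val_eqE /h -!val_eqE /=.
have [/= x0|/= x0] := eqVneq (val x) 0; have [/= y0|/= y0] := eqVneq (val y) 0.
- by case/eqP: xy; apply: val_inj; exact: etrans x0 (esym y0).
- by rewrite dist0n dD andbT; lia.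
- by rewrite addn0 dD andbT -lt0n.
- by case/eqP: xy; apply: val_inj => /=; move: x0 y0 (ltn_ord x) (ltn_ord y); lia.
Qed.

(** Of two consecutive integers at most one is a multiple of [m > 1], so the induction advances by
    two. *)
Lemma count_ndvdn (m a N : nat) :
  1 < m -> N %/ 2 <= count (fun x => ~~ (m %| x)) (iota a N).
Proof.
move=> m_gt1; elim/ltn_ind: N a => -[|[|N]] IH a //=.
have := IH N _ a.+2; rewrite !ltnS leqnSn => /(_ isT).
have : ~~ ((m %| a) && (m %| a.+1)).
  apply/negP=> /andP[ma]; rewrite -addn1 dvdn_addr // dvdn1; lia.
case: (m %| a); case: (m %| a.+1) => //=; lia.
Qed.

Lemma chi_path_attained (n k m : nat) :
  k <= n %/ 2 -> 2 <= m <= k + 1 -> k + 1 <= n ->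
  exists D : {fset nat},
    [/\ (D `<=` nat_range 1 (n - 1))%fset, #|` D| = k & chi_path n D = m].
Proof.
move=> k_half /andP[m_ge2 m_le] k_lt.
pose s := [seq x <- iota 1 (n - 1) | ~~ (m %| x)].
have sub_s x : x \in take k s -> (0 < x < n) && ~~ (m %| x).
  by move/mem_take; rewrite mem_filter mem_iota => /andP[->]; lia.
have small x : 0 < x < m -> x \in take k s.
  move=> x_m; rewrite /s.
  (* The integers [1, ..., m - 1] are not multiples of [m], so they open the list [s]; [m - 1 <= k]
     keeps them all in [take k s]. *)
  have -> : n - 1 = (m - 1) + (n - m) by lia.
  have ndvd : all (fun x => ~~ (m %| x)) (iota 1 (m - 1)).
    by apply/allP=> y; rewrite mem_iota => y_m; rewrite gtnNdvd //; lia.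
  rewrite iotaD filter_cat (all_filterP ndvd) take_cat size_iota.
  by case: ltnP => [|_]; [lia | rewrite mem_cat mem_iota; apply/orP; left; lia].
have uniq_s : uniq (take k s) by rewrite take_uniq ?filter_uniq ?iota_uniq.
have size_s : k <= size s.
  (* Removing 0, a multiple of m, from the n integers 0, ..., n - 1. *)
  rewrite size_filter; have := @count_ndvdn m 0 n m_ge2.
  have n_eq : n = (n - 1).+1 by lia.
  by rewrite {2}n_eq /= dvdn0; apply: leq_trans.
exists [fset x in take k s]%fset.
have memD x : (x \in [fset x in take k s]%fset) = (x \in take k s).
  by rewrite in_fset_.
split.
- by apply/fsubsetP=> x; rewrite memD mem_nat_range => /sub_s; lia.
- by rewrite card_fseq undup_id // size_takel.
have m_le_n : m <= n by lia.
apply/eqP; rewrite eqn_leq; apply/andP; split.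
  apply: chromatic_number_le; apply: (@distance_colorable _ _ _ (modn^~ m)).
    by move=> i; rewrite ltn_mod; lia.
  (* Equal residues would make [m] divide [j - i], an element of [D]. *)
  move=> i j ij; rewrite memD => /sub_s/andP[_].
  by rewrite eq_sym eqn_mod_dvd //; lia.
apply: (@chi_path_ge _ _ _ (widen_ord m_le_n)) => x y xy.
rewrite /distance_adj /= memD -!val_eqE /= val_eqE xy /path_dist /=.
by apply: small; move: xy (ltn_ord x) (ltn_ord y); rewrite -val_eqE /=; lia.
Qed.

Theorem theorem2p2 (n k : nat) (k_gt0 : 0 < k) (k_lt_n : k + 1 <= n)
    (k_le_half : k <= n %/ 2) :
  Spec n k = nat_range 2 (k + 1).
Proof.
apply/fsetP=> m; rewrite mem_nat_range; apply/imfsetP/idP => /=.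
  case=> D; rewrite inE fpowersetE => /andP[/fsubsetP DS /eqP cD] ->.
  have [d dD] : exists d, d \in D by apply/fset0Pn; rewrite -cardfs_gt0 cD.
  rewrite -cD chi_path_le andbT; apply: (@chi_path_ge2 _ d) => //.
  by have := DS _ dD; rewrite mem_nat_range; lia.
move=> m_range; have [D [DS cD <-]] := chi_path_attained k_le_half m_range k_lt_n.
by exists D; rewrite // inE fpowersetE DS cD eqxx.
Qed.
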